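(* Let $\Bbbk$ be a field of characteristic zero, let $C$ be an associative conformal algebra generated by a set $X$ relative to a locality function $N:X\times X\to\mathbb Z_+$, and let $M$ be a left conformal $C$-module generated by a set $Y$ (disjoint from $X$) relative to a locality function $N':X\times Y\to\mathbb Z_+$. Then a Gröbner–Shirshov basis of the conformal module $M$ over $C$ consists of all those relations from a Gröbner–Shirshov basis of the split null extension $C\oplus M$ (as an associative conformal algebra generated by $X\cup Y$) that contain a single letter $y\in Y$.
   Context: Let $H=\Bbbk[\partial]$. Associative conformal algebra: a left $H$-module $C$ with a $\Bbbk$-bilinear operation $(\cdot\,{}_{(\lambda)}\,\cdot):C\otimes C\to C[\lambda]$ such that $(\partial a\,{}_{(\lambda)}\,b)=-\lambda(a\,{}_{(\lambda)}\,b)$, $(a\,{}_{(\lambda)}\,\partial b)=(\partial+\lambda)(a\,{}_{(\lambda)}\,b)$ and $(a\,{}_{(\lambda)}(b\,{}_{(\mu)}c))=((a\,{}_{(\lambda)}b)\,{}_{(\lambda+\mu)}c)$. A left conformal $C$-module is an $H$-module $M$ with $(\cdot\,{}_{(\lambda)}\,\cdot):C\otimes M\to M[\lambda]$ satisfying the same identities. The locality functions bound degrees: $\deg_\lambda(a\,{}_{(\lambda)}b)<N(a,b)$ for $a,b\in X$ and $\deg_\lambda(x\,{}_{(\lambda)}y)<N'(x,y)$ for $x\in X$, $y\in Y$ (a value $0$ meaning that the product is zero). The split null extension $C\oplus M$ is the associative conformal algebra whose $\lambda$-product extends that of $C$ and the action of $C$ on $M$, with $(M\,{}_{(\lambda)}M)=(M\,{}_{(\lambda)}C)=0$;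 its locality function on $X\cup Y$ equals $N$ on $X\times X$, $N'$ on $X\times Y$, and $0$ on $Y\times X$ and $Y\times Y$. For a set $Z$, $A(Z)$ is the unital associative algebra generated by $\{\partial\}\cup\{L_n^a,R_n^a\mid a\in Z,\ n\in\mathbb Z_+\}$ with defining relations $L_n^a\partial-\partial L_n^a-nL_{n-1}^a$, $R_n^a\partial-\partial R_n^a-nR_{n-1}^a$, $R_n^aL_m^b-L_m^bR_n^a$ ($a,b\in Z$, $n,m\ge0$). An associative conformal algebra generated by $Z$ is an $A(Z)$-module via $(a\,{}_{(\lambda)}u)=\sum_{n\ge0}\frac{\lambda^n}{n!}L_n^au$, $(u\,{}_{(-\lambda-\partial)}a)=\sum_{n\ge0}\frac{\lambda^n}{n!}R_n^au$, $a\in Z$, and is thus a quotient of the free left $A(Z)$-module $A(Z)\otimes\Bbbk Z$. A Gröbner–Shirshov basis of an associative conformal algebra generated by $Z$ means a Gröbner–Shirshov basis of the $A(Z)$-submodule of relations in $A(Z)\otimes\Bbbk Z$ (with respect to a monomial order), i.e., a generating set of relations which, viewed as rewriting rules (leading monomial $\to$ the remaining terms), is confluent, so that the irreducible monomials form a linear basis of the quotient. Count the letters from $Y$ in a monomial of $A(X\cup Y)\otimes\Bbbk(X\cup Y)$ by counting both module generators $y\in Y$ and operators $L_n^y,R_n^y$. The defining relations of $C\oplus M$ are homogeneous with respect to this number, and Gröbner–Shirshov bases of $C\oplus M$ are understood to consist of homogeneous relations. A relation contains a single letter $y\in Y$ if each of its monomials contains exactly one letter from $Y$. A set of such relations is called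 a Gröbner–Shirshov basis of the conformal module $M$ over $C$ if, together with the Gröbner–Shirshov basis of $C$ (the relations in the Gröbner–Shirshov basis of $C\oplus M$ containing no letters from $Y$), it is a confluent set of rewriting rules on the monomials containing exactly one letter from $Y$, and the irreducible monomials among these form a linear basis of $M$. *)

(* Defs.v *)
From HB Require Import structures.
From Stdlib Require Import Relation_Operators.
From mathcomp Require Import all_boot all_order all_algebra.
From mathcomp Require Import finmap monalg.

Set Implicit Arguments.
Unset Strict Implicit.
Unset Printing Implicit Defensive.

Import GRing.Theory.
Local Open Scope ring_scope.

(* H = k[d] is {poly k}; d acts on a left H-module by 'X and c : k by c%:P.
   V[lambda] is {malg V[nat]}: p@_n is the coefficient of lambda^n (without a
   factor 1/n`!). *)

Section ConformalAxioms.
Variables (k : fieldType) (C V : lmodType {poly k}).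

(* coefficient of lambda^n in lambda * p *)
Definition lambda_mul (p : {malg V[nat]}) (n : nat) : V :=
  if n is n'.+1 then p@_n' else 0.

(* Associativity is the comparison of the coefficients of lambda^i mu^j in
   (a _lambda (b _mu v)) and ((a _lambda b) _(lambda + mu) v). *)
Record conformal_action (mul : C -> C -> {malg C[nat]})
    (act : C -> V -> {malg V[nat]}) : Prop := ConformalAction {
  act_linearl : forall (c : k) a a' v n,
    (act (c%:P *: a + a') v)@_n = c%:P *: (act a v)@_n + (act a' v)@_n;
  act_linearr : forall (c : k) a v v' n,
    (act a (c%:P *: v + v'))@_n = c%:P *: (act a v)@_n + (act a v')@_n;
  act_derl : forall a v n, (act ('X *: a) v)@_n = - lambda_mul (act a v) n;
  act_derr : forall a v n,
    (act a ('X *: v))@_n = 'X *: (act a v)@_n + lambda_mul (act a v) n;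
  act_assoc : forall a b v i j,
    (act a (act b v)@_j)@_i =
    \sum_(l < i.+1) (act (mul a b)@_(val l) v)@_(i - l + j)%N *+ 'C(i - l + j, j)
}.

Definition H_submodule (P : V -> Prop) : Prop :=
  P 0 /\ forall (h : {poly k}) u v, P u -> P v -> P (h *: u + v).

End ConformalAxioms.

Record confAlg (k : fieldType) := ConfAlg {
  confAlg_sort :> lmodType {poly k};
  lprod : confAlg_sort -> confAlg_sort -> {malg confAlg_sort[nat]};
  lprodP : conformal_action lprod lprod
}.

Record confMod (k : fieldType) (C : confAlg k) := ConfMod {
  confMod_sort :> lmodType {poly k};
  lact : C -> confMod_sort -> {malg confMod_sort[nat]};
  lactP : conformal_action (@lprod k C) lact
}.

Section Generation.
Variables (k : fieldType) (C : confAlg k).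

Record alg_generated (Z : Type) (zeta : Z -> C) (N : Z -> Z -> nat) : Prop :=
  AlgGenerated {
    alg_gen : forall P : C -> Prop, H_submodule P ->
      (forall a b n, P a -> P b -> P (lprod a b)@_n) ->
      (forall z, P (zeta z)) -> forall c, P c;
    alg_loc : forall a b n, (N a b <= n)%N ->
      (lprod (zeta a) (zeta b))@_n = 0
  }.

Record mod_generated (M : confMod C) (X Y : Type) (xi : X -> C) (eta : Y -> M)
    (N' : X -> Y -> nat) : Prop := ModGenerated {
  mod_gen : forall P : M -> Prop, H_submodule P ->
    (forall (a : C) v n, P v -> P (lact a v)@_n) ->
    (forall y, P (eta y)) -> forall v, P v;
  mod_loc : forall x y n, (N' x y <= n)%N -> (lact (xi x) (eta y))@_n = 0
}.

End Generation.

Section SplitNull.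
Variables (k : fieldType) (C : confAlg k) (M : confMod C).

Definition pair_coef (p : {malg C[nat]}) (q : {malg M[nat]}) :
    {malg (C * M)%type[nat]} :=
  [malg n in (msupp p `|` msupp q)%fset => (p@_n, q@_n)].

Definition split_null_prod (a b : (C * M)%type) : {malg (C * M)%type[nat]} :=
  pair_coef (lprod a.1 b.1) (lact a.1 b.2).

Lemma pair_coefE p q n : (pair_coef p q)@_n = (p@_n, q@_n).
Proof.
rewrite /pair_coef mcoeffE in_fsetU.
by do 2?case: msuppP.
Qed.

Lemma split_null_prodE a b n :
  (split_null_prod a b)@_n = ((lprod a.1 b.1)@_n, (lact a.1 b.2)@_n).
Proof. exact: pair_coefE. Qed.

Lemma lambda_mul_pair a b n :
  lambda_mul (split_null_prod a b) n =
  (lambda_mul (lprod a.1 b.1) n, lambda_mul (lact a.1 b.2) n).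
Proof. by case: n => [|n] //=; rewrite split_null_prodE. Qed.

Lemma split_null_conformal : conformal_action split_null_prod split_null_prod.
Proof.
have [l1 l2 l3 l4 l5] := lprodP C; have [m1 m2 m3 m4 m5] := lactP M.
split=> [c a a' v n|c a v v' n|a v n|a v n|a b v i j].
- by rewrite !split_null_prodE /= l1 m1.
- by rewrite !split_null_prodE /= l2 m2.
- by rewrite lambda_mul_pair split_null_prodE /= l3 m3.
- by rewrite lambda_mul_pair !split_null_prodE /= l4 m4.
- rewrite !split_null_prodE /= l5 m5.
  under [RHS]eq_bigr => l _ do rewrite !split_null_prodE /=.
  have pairMn (u : C) (w : M) n :
      ((u, w) : (C * M)%type) *+ n = (u *+ n, w *+ n).
    by elim: n => [|n IHn]; rewrite ?mulr0n // !mulrS IHn.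
  by elim/big_rec3: _ => // l x1 x2 x3 _ <-; rewrite pairMn.
Qed.

Definition split_null : confAlg k := ConfAlg split_null_conformal.

Variables (X Y : Type) (xi : X -> C) (eta : Y -> M).

Definition split_gen (z : X + Y) : split_null :=
  match z with inl x => (xi x, 0) | inr y => (0, eta y) end.

Definition split_loc (N : X -> X -> nat) (N' : X -> Y -> nat)
    (a b : X + Y) : nat :=
  match a, b with
  | inl x, inl x' => N x x'
  | inl x, inr y => N' x y
  | inr _, _ => 0%N
  end.

Lemma split_null_generated N N' :
  alg_generated xi N -> mod_generated xi eta N' ->
  alg_generated split_gen (split_loc N N').
Proof.
move=> [gC lC] [gM lM].
have [l1 l2 l3 l4 l5] := lprodP C; have [m1 m2 m3 m4 m5] := lactP M.
have l0 (b : C) n : (lprod (0 : C) b)@_n = 0.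
  by have := l1 (-1) 0 0 b n; rewrite scaler0 addr0 polyCN scaleN1r addNr.
have m0 (b : M) n : (lact (0 : C) b)@_n = 0.
  by have := m1 (-1) 0 0 b n; rewrite scaler0 addr0 polyCN scaleN1r addNr.
have l0' (b : C) n : (lprod b (0 : C))@_n = 0.
  by have := l2 (-1) b 0 0 n; rewrite scaler0 addr0 polyCN scaleN1r addNr.
have m0' (b : C) n : (lact b (0 : M))@_n = 0.
  by have := m2 (-1) b 0 0 n; rewrite scaler0 addr0 polyCN scaleN1r addNr.
have pairZD (h : {poly k}) (a b : C) (u v : M) :
  h *: ((a, u) : split_null) + (b, v) = (h *: a + b, h *: u + v) by [].
split.
- move=> P [P0 PD] Pp Pg.
  have PC c : P (c, 0).
    apply: (gC (fun c => P (c, 0))) => [||x]; last exact: (Pg (inl x)).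
      split=> // h u v Pu Pv.
      by have := PD h _ _ Pu Pv; rewrite pairZD scaler0 addr0.
    move=> a b n Pa Pb; have := Pp _ _ n Pa Pb.
    by rewrite split_null_prodE /= m0'.
  have PM v : P (0, v).
    apply: (gM (fun v => P (0, v))) => [||y]; last exact: (Pg (inr y)).
      split=> // h u w Pu Pw.
      by have := PD h _ _ Pu Pw; rewrite pairZD scaler0 addr0.
    move=> a v' n Pv; have := Pp _ _ n (PC a) Pv.
    by rewrite split_null_prodE /= l0'.
  case=> c v; have := PD 1 _ _ (PC c) (PM v).
  by rewrite pairZD !scale1r addr0 add0r.
- case=> [x|y] [x'|y'] n /= le_n; rewrite split_null_prodE /=.
  + by rewrite lC // m0'.
  + by rewrite l0' lM.
  + by rewrite l0 m0.
  + by rewrite l0 m0.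
Qed.

End SplitNull.

Inductive letter (Z : Type) : Type :=
  Dlet | Llet of nat & Z | Rlet of nat & Z.
Arguments Dlet {Z}.

Section LetterChoice.
Variable Z : choiceType.

Definition letter_code (l : letter Z) : option (bool * nat * Z) :=
  match l with
  | Dlet => None
  | Llet n a => Some (true, n, a)
  | Rlet n a => Some (false, n, a)
  end.

Definition letter_decode (o : option (bool * nat * Z)) : letter Z :=
  match o with
  | None => Dlet
  | Some (true, n, a) => Llet n a
  | Some (false, n, a) => Rlet n a
  end.

Lemma letter_codeK : cancel letter_code letter_decode.
Proof. by case. Qed.

HB.instance Definition _ := Choice.copy (letter Z) (can_type letter_codeK).

End LetterChoice.

Section FreeModule.
Variables (k : fieldType) (Z : choiceType).

Definition word := {fmonom (letter Z)}.

(* free unital associative k-algebra on d, L_n^a, R_n^a *)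
Definition opAlg := {malg k[word]}.

(* free left opAlg-module on Z. The free A(Z)-module A(Z) (x) kZ is its quotient
   by the submodule generated by A_rule below, so that A(Z)-submodules of
   A(Z) (x) kZ are the submodules of freeMod containing A_rule. Relations are
   written in words, and the defining relations of A(Z) always take part as
   rewriting rules; their normal forms are the monomials d^s L..L R..R z. *)
Definition freeMod := {malg opAlg[Z]}.

(* the monomial w (x) z *)
Definition mono := (word * Z)%type.

Definition coef (p : freeMod) (m : mono) : k := (p@_m.2)@_m.1.

Definition wmul (u : word) (m : mono) : mono := (mmul u m.1, m.2).

Definition dw : word := fmu Dlet.
Definition Lw n a : word := fmu (Llet n a).
Definition Rw n a : word := fmu (Rlet n a).
Definition dX : opAlg := << dw >>.
Definition LX n a : opAlg := << Lw n a >>.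
Definition RX n a : opAlg := << Rw n a >>.

(* Presentation of A(Z). A_rel w r: r is a defining relation of A(Z), with intended leading word w.
   For n = 0 the terms with n.-1 have coefficient 0. *)
Inductive A_rel : word -> opAlg -> Prop :=
| A_relL n a :
    A_rel (mmul (Lw n a) dw) (LX n a * dX - dX * LX n a - LX n.-1 a *+ n)
| A_relR n a :
    A_rel (mmul (Rw n a) dw) (RX n a * dX - dX * RX n a - RX n.-1 a *+ n)
| A_relRL n m a b :
    A_rel (mmul (Rw n a) (Lw m b)) (RX n a * LX m b - LX m b * RX n a).

(* The left submodule generated by these elements r v (x) z (v a word) is
   I (x) kZ, with I the two-sided ideal of defining relations of A(Z). *)
Definition A_rule (s : freeMod) : Prop :=
  exists w r (v : word) z, A_rel w r /\ s = << r * << v >> *g z >>.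

Definition union_rules (S S' : freeMod -> Prop) (s : freeMod) : Prop := S s \/ S' s.

Inductive submodule (S : freeMod -> Prop) : freeMod -> Prop :=
| submod0 : submodule S 0
| submodD t s p : S s -> submodule S p -> submodule S (t *: s + p).

Variable lt : rel mono.

Definition is_lead (s : freeMod) (m : mono) : Prop :=
  coef s m != 0 /\ forall m', coef s m' != 0 -> m' != m -> lt m' m.

Record monomial_order : Prop := MonomialOrder {
  mo_irr : irreflexive lt;
  mo_trans : transitive lt;
  mo_total : forall m m', m != m' -> lt m m' || lt m' m;
  mo_wf : well_founded (fun m m' => lt m m' : Prop);
  mo_mul : forall u m m', lt m m' -> lt (wmul u m) (wmul u m');
  (* the defining relations of A(Z) are oriented as L d -> d L + n L, R d -> d R + n R, R L -> L R *)
  mo_lead : forall w r (v : word) z, A_rel w r ->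
    is_lead << r * << v >> *g z >> (mmul w v, z)
}.

(* One step: p contains the monomial u * lead(s) and the multiple of u s that
   cancels it is subtracted from p. *)
Definition rewrites (S : freeMod -> Prop) (p q : freeMod) : Prop :=
  exists s m u, [/\ S s, is_lead s m, coef p (wmul u m) != 0 &
    q = p - (<< coef p (wmul u m) / coef s m *g u >> : opAlg) *: s].

Definition rewrites_star (S : freeMod -> Prop) : freeMod -> freeMod -> Prop :=
  clos_refl_trans freeMod (rewrites S).

(* Confluence of the rules S on the polynomials all of whose monomials lie
   in D. *)
Definition confluent_on (D : mono -> Prop) (S : freeMod -> Prop) : Prop :=
  forall p q q', (forall m, coef p m != 0 -> D m) ->
    rewrites_star S p q -> rewrites_star S p q' ->
    exists2 r, rewrites_star S q r & rewrites_star S q' r.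

Definition irreducible_mono (S : freeMod -> Prop) (m : mono) : Prop :=
  forall s m' u, S s -> is_lead s m' -> m <> wmul u m'.

End FreeModule.

Section Evaluation.
Variables (k : fieldType) (Z : choiceType) (C : confAlg k) (zeta : Z -> C).

Definition Lop n (a u : C) : C := (n`!)%:R *: (lprod a u)@_n.

(* n`! times the coefficient of lambda^n in (u _mu a) at mu = - lambda - d *)
Definition Rop n (a u : C) : C :=
  \sum_(m <- msupp (lprod u a))
    ((n`!)%:R * (-1) ^+ m * ('C(m, n))%:R * 'X^(m - n)) *: (lprod u a)@_m.

Definition letter_op (l : letter Z) (u : C) : C :=
  match l with
  | Dlet => 'X *: u
  | Llet n a => Lop n (zeta a) u
  | Rlet n a => Rop n (zeta a) u
  end.

Definition eval_mono (m : mono Z) : C := foldr letter_op (zeta m.2) m.1.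

(* the A(Z)-linear map A(Z) (x) kZ -> C extending zeta *)
Definition eval (p : freeMod k Z) : C :=
  \sum_(z <- msupp p) \sum_(w <- msupp p@_z)
    (coef p (w, z))%:P *: eval_mono (w, z).

Definition GSB (lt : rel (mono Z)) (G : freeMod k Z -> Prop) : Prop :=
  (forall p, eval p = 0 <-> submodule (union_rules (@A_rule k Z) G) p) /\
  confluent_on lt (fun _ => True) (union_rules (@A_rule k Z) G).

End Evaluation.

(* The family (e m), m in D, is a k-linear basis of V. *)
Definition linear_basis (k : fieldType) (Z : choiceType) (V : lmodType {poly k})
    (D : mono Z -> Prop) (e : mono Z -> V) : Prop :=
  (forall (r : seq (mono Z)) (c : mono Z -> k), uniq r ->
     (forall m, m \in r -> D m) ->
     \sum_(m <- r) (c m)%:P *: e m = 0 -> forall m, m \in r -> c m = 0) /\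
  (forall v, exists (r : seq (mono Z)) (c : mono Z -> k),
     (forall m, m \in r -> D m) /\ v = \sum_(m <- r) (c m)%:P *: e m).

Section YLetters.
Variables (k : fieldType) (X Y : choiceType).

Definition isY (z : X + Y) : bool := if z is inr _ then true else false.

Definition letterY (l : letter (X + Y)%type) : bool :=
  match l with Dlet => false | Llet _ z | Rlet _ z => isY z end.

Definition ycount (m : mono (X + Y)%type) : nat :=
  (count letterY m.1 + isY m.2)%N.

Definition Y_homogeneous (d : nat) (p : freeMod k (X + Y)%type) : Prop :=
  forall m, coef p m != 0 -> ycount m = d.

(* S is a Groebner-Shirshov basis of the conformal module M over C, relative to
   a Groebner-Shirshov basis G of the split null extension; the part of G
   without letters from Y is the Groebner-Shirshov basis of C. A monomial with
   exactly one letter from Y takes its value in the summand M = 0 (+) M of the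
   split null extension, whence the projection .2 in mGSB_basis. *)
Record module_GSB (C : confAlg k) (M : confMod C) (xi : X -> C) (eta : Y -> M)
    (lt : rel (mono (X + Y)%type)) (G S : freeMod k (X + Y)%type -> Prop)
    : Prop := ModuleGSB {
  mGSB_single : forall s, S s -> Y_homogeneous 1 s;
  mGSB_rel : forall s, S s -> eval (split_gen xi eta) s = 0;
  mGSB_confluent : confluent_on lt (fun m => ycount m = 1%N)
    (union_rules (@A_rule k _) (union_rules (fun g => G g /\ Y_homogeneous 0 g) S));
  mGSB_basis : linear_basis
    (fun m => ycount m = 1%N /\ irreducible_mono lt
       (union_rules (@A_rule k _) (union_rules (fun g => G g /\ Y_homogeneous 0 g) S)) m)
    (fun m => (eval_mono (split_gen xi eta) m).2 : M)
}.

End YLetters.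

(* Main.v *)
(* All rules are homogeneous in the number of letters from Y and rewriting
   preserves this number. So on polynomials of degree 1 only rules of degree
   at most 1 ever apply, and confluence of the restricted system is inherited
   from that of the split null extension. Linear independence of the normal
   words is inherited in the same way: by confluence a relation reduces to 0,
   whereas a combination of irreducible monomials reduces only to itself.
   They span M because M is generated from Y under d and the operators L_n^x
   alone: by associativity, (a_n b)_m v lies in every subspace that is stable
   under the actions of a and of b. *)
Require Import Defs.
From Stdlib Require Import Classical Relation_Operators Operators_Properties.
From mathcomp Require Import all_boot all_order all_algebra.
From mathcomp Require Import finmap monalg.
Import GRing.Theory.
Local Open Scope ring_scope.

Set Implicit Arguments.
Unset Strict Implicit.
Unset Printing Implicit Defensive.

(** * Coefficients and supports in the free module *)

Section Coefficients.
Variables (k : fieldType) (Z : choiceType).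
Implicit Types (p q s : freeMod k Z) (m : mono Z) (u v : word Z) (c : k).

Definition supp p : seq (mono Z) :=
  [seq (w, z) | z <- msupp p, w <- msupp p@_z].

Lemma mem_supp p m : (m \in supp p) = (coef p m != 0).
Proof.
case: m => w z; rewrite /coef /= mcoeff_neq0.
apply/allpairsPdep/idP => [[z' [w' [_ w'P [-> ->]]]] // | wP].
exists z, w; split=> //; rewrite -mcoeff_neq0.
by apply: contraTneq wP => ->; rewrite msupp0.
Qed.

Lemma supp_uniq p : uniq (supp p).
Proof.
apply: allpairs_uniq_dep => [|z _|[z w] [z' w'] _ _ /= [-> ->]] //;
  exact: fset_uniq.
Qed.

Lemma coefP p q : (forall m, coef p m = coef q m) -> p = q.
Proof.
by move=> eq_pq; apply/malgP=> z; apply/malgP=> w; apply: (eq_pq (w, z)).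
Qed.

Lemma coef0 m : coef (0 : freeMod k Z) m = 0.
Proof. by rewrite /coef !mcoeff0. Qed.

Lemma coefD p q m : coef (p + q) m = coef p m + coef q m.
Proof. by rewrite /coef !mcoeffD. Qed.

Lemma coefB p q m : coef (p - q) m = coef p m - coef q m.
Proof. by rewrite /coef !mcoeffB. Qed.

Definition term c m : freeMod k Z := << << c *g m.1 >> *g m.2 >>.

Lemma coef_term c m m' : coef (term c m) m' = c *+ (m == m').
Proof.
case: m m' => [w z] [w' z']; rewrite /coef /term /= mcoeffU mcoeffMn mcoeffU.
by rewrite xpair_eqE -mulrnA mulnb.
Qed.

Lemma coef_sum_term (r : seq (mono Z)) (c : mono Z -> k) m : uniq r ->
  coef (\sum_(m' <- r) term (c m') m') m = c m *+ (m \in r).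
Proof.
elim: r => [|m' r IHr] /=; first by rewrite big_nil coef0.
case/andP=> m'r Ur; rewrite big_cons coefD IHr // coef_term inE eq_sym.
by case: eqVneq => [->|_]; rewrite ?(negbTE m'r) ?addr0 ?add0r.
Qed.

Lemma wmul_inj u : injective (@wmul Z u).
Proof.
move=> [w z] [w' z'] [eq_w ->]; congr (_, _).
apply/eqP; rewrite fmP; move/(congr1 (fun x : word Z => x : seq _)): eq_w.
by rewrite /= !fmM => /eqP; rewrite eqseq_cat // eqxx.
Qed.

Lemma coef_scale c u s m' :
  coef ((<< c *g u >> : opAlg k Z) *: s) m' =
  \sum_(m <- supp s) (c * coef s m) *+ (wmul u m == m').
Proof.
rewrite [supp s]lock /coef mcoeffZ -lock; case: m' => [w' z'] /=.
have -> : (<< c *g u >> : opAlg k Z) * s@_z' =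
    \sum_(w <- msupp s@_z') << c * (s@_z')@_w *g mmul u w >>.
  exact: fgmulUg.
rewrite raddf_sum /= big_allpairs_dep /=.
have [zP|zNP] := boolP (z' \in msupp s); last first.
  rewrite (mcoeff_outdom zNP) msupp0 big_nil big_seq big1 // => z zP.
  rewrite big1 // => w _; rewrite xpair_eqE.
  by case: (eqVneq z z') zNP => [<-|_]; rewrite ?zP // andbF.
rewrite (bigD1_seq z') ?fset_uniq //= [X in _ + X]big1 ?addr0 => [|z zz'].
  by apply: eq_bigr => w _; rewrite mcoeffU xpair_eqE eqxx andbT.
by rewrite big1 // => w _; rewrite xpair_eqE (negbTE zz') andbF.
Qed.

Lemma coef_scale_wmul c u s m :
  coef ((<< c *g u >> : opAlg k Z) *: s) (wmul u m) = c * coef s m.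
Proof.
rewrite coef_scale; under eq_bigr => m' _ do rewrite (inj_eq (@wmul_inj u)).
have [mP|] := boolP (m \in supp s); last first.
  move=> mNP; rewrite (_ : coef s m = 0); last first.
    by apply/eqP; move: mNP; rewrite mem_supp negbK.
  rewrite mulr0 big_seq big1 // => m' m'P.
  by case: eqVneq mNP => // <-; rewrite m'P.
rewrite (bigD1_seq m) ?supp_uniq //= eqxx big1 ?addr0 // => m' /negbTE->.
by rewrite mulr0n.
Qed.

(** [coef_scale] writes the coefficient as a sum over [supp s]; if no summand hits [m'], the sum is
    zero. *)
Lemma coef_scale_neq0 c u s m' :
  coef ((<< c *g u >> : opAlg k Z) *: s) m' != 0 ->
  exists2 m, m' = wmul u m & coef s m != 0.
Proof.
move=> nz; have [/hasP[m mP /eqP <-]|/hasPn no] :=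
    boolP (has (fun m => wmul u m == m') (supp s)).
  by exists m; rewrite // -mem_supp.
move: nz; rewrite coef_scale big_seq big1 ?eqxx // => m /no /negbTE->.
exact: mulr0n.
Qed.

End Coefficients.

(** * Existence of leading monomials *)

Section Leading.
Variables (k : fieldType) (Z : choiceType) (lt : rel (mono Z)).
Hypothesis hlt : monomial_order k lt.

Lemma lead_exists (s : freeMod k Z) : s != 0 -> exists m, is_lead lt s m.
Proof.
have max_seq (m0 : mono Z) r : exists2 m, m \in m0 :: r &
    forall m', m' \in m0 :: r -> m' != m -> lt m' m.
  elim: r => [|m1 r [m mP mmax]].
    by exists m0; rewrite ?mem_head // => m'; rewrite inE => ->.
  have [le_m1m|] := boolP ((m1 == m) || lt m1 m).
    exists m; first by move: mP; rewrite !inE => /orP[]->; rewrite ?orbT.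
    move=> m'; rewrite !inE => /or3P[] m'P; last 1 first.
    - by apply: mmax; rewrite inE m'P orbT.
    - by apply: mmax; rewrite inE m'P.
    by move/negbTE => ne; move: le_m1m; rewrite -(eqP m'P) ne.
  rewrite negb_or => /andP[ne_m1m nlt].
  have lt_mm1 : lt m m1.
    by case/orP: (mo_total hlt ne_m1m) => // lt'; rewrite lt' in nlt.
  exists m1; first by rewrite !inE eqxx orbT.
  move=> m' m'P ne; have [->//|ne'] := eqVneq m' m.
  apply: (mo_trans hlt) lt_mm1; apply: mmax => //.
  by move: m'P; rewrite !inE (negbTE ne).
move=> s0; case Es: (supp s) => [|m0 r].
  case/eqP: s0; apply: coefP => m; rewrite coef0; apply/eqP.
  by apply: negbNE; rewrite -mem_supp Es.
have [m mP mmax] := max_seq m0 r; exists m.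
split=> [|m']; rewrite -mem_supp Es //; exact: mmax.
Qed.

End Leading.

(** * Confluence and membership in the submodule of relations *)

Section Reduction.
Variables (k : fieldType) (Z : choiceType) (lt : rel (mono Z)).
Hypothesis hlt : monomial_order k lt.
Variable S : freeMod k Z -> Prop.
Implicit Types (p q s : freeMod k Z) (m : mono Z) (u : word Z) (c : k).

Definition joinable p q : Prop :=
  exists2 r, rewrites_star lt S p r & rewrites_star lt S q r.

Lemma joinable_refl p : joinable p p.
Proof. by exists p; apply: rt_refl. Qed.

(** A rewriting step requires a nonzero coefficient; if the coefficient is zero, nothing is
    subtracted and the empty reduction serves. Later arguments thus avoid this case distinction. *)
Lemma reduce_at p s m u : S s -> is_lead lt s m ->
  rewrites_star lt S p
    (p - (<< coef p (wmul u m) / coef s m *g u >> : opAlg k Z) *: s).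
Proof.
move=> Ss lead_m; have [p0|pN0] := eqVneq (coef p (wmul u m)) 0.
  by rewrite p0 mul0r monalgU0 scale0r subr0; apply: rt_refl.
by apply: rt_step; exists s, m, u.
Qed.

(** The two sides differ by a multiple of [u] times [s], so cancelling the monomial [wmul u m] with
    the rule [s] on both sides yields the same element. *)
Lemma joinable_addl c u s p : S s ->
  joinable ((<< c *g u >> : opAlg k Z) *: s + p) p.
Proof.
move=> Ss; have [->|/(lead_exists hlt) [m lead_m]] := eqVneq s 0.
  by rewrite scaler0 add0r; apply: joinable_refl.
set q := _ + p.
exists (p - (<< coef p (wmul u m) / coef s m *g u >> : opAlg k Z) *: s);
  last exact: reduce_at.
have -> : p - (<< coef p (wmul u m) / coef s m *g u >> : opAlg k Z) *: s =
    q - (<< coef q (wmul u m) / coef s m *g u >> : opAlg k Z) *: s.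
  rewrite coefD coef_scale_wmul mulrDl mulfK; last by case: lead_m.
  by rewrite monalgUD scalerDl /q addrC opprD addrACA subrr add0r addrC.
exact: reduce_at.
Qed.

Hypothesis conf : confluent_on lt (fun _ => True) S.

(** Confluence enters here: the two reducts of the middle element [q] have a common reduct. *)
Lemma joinable_trans q p r : joinable p q -> joinable q r -> joinable p r.
Proof.
case=> a pa qa [b qb rb]; have [|d ad bd] := conf _ qa qb; first by [].
by exists d; [apply: rt_trans ad | apply: rt_trans bd].
Qed.

Lemma joinable_scale t s p : S s -> joinable (t *: s + p) p.
Proof.
move=> Ss; rewrite [t]monalgE; elim: (msupp t : seq _) => [|u r IHr].
  by rewrite big_nil scale0r add0r; apply: joinable_refl.
rewrite big_cons scalerDl -addrA.
by apply: joinable_trans IHr; apply: joinable_addl.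
Qed.

Lemma submodule_joinable p : submodule S p -> joinable p 0.
Proof.
elim=> [|t s q Ss _ IHq]; first exact: joinable_refl.
by apply: joinable_trans IHq; apply: joinable_scale.
Qed.

Lemma irreducible_star p q :
  (forall m, coef p m != 0 -> irreducible_mono lt S m) ->
  rewrites_star lt S p q -> q = p.
Proof.
move=> irr /clos_rt_rt1n_iff [//|q' r [s [m [u [Ss lead_m nz _]]]]].
by case: (irr _ nz s m u Ss lead_m).
Qed.

(** The common reduct of [p] and 0 equals [p], since [p] is irreducible, and equals 0, since 0 has
    no monomials. *)
Lemma irreducible_submodule p :
  (forall m, coef p m != 0 -> irreducible_mono lt S m) ->
  submodule S p -> p = 0.
Proof.
move=> irr /submodule_joinable [r p_r r0].
rewrite -(irreducible_star irr p_r); apply: irreducible_star r0 => m.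
by rewrite coef0 eqxx.
Qed.

End Reduction.

Lemma sub_rewrites_star (k : fieldType) (Z : choiceType) (lt : rel (mono Z))
    (S S' : freeMod k Z -> Prop) (p q : freeMod k Z) :
  (forall s, S s -> S' s) -> rewrites_star lt S p q -> rewrites_star lt S' p q.
Proof.
move=> sSS'; elim=> [a b [s [m [u [Ss lead_m nz ->]]]]|a|a b c _ ? _ ?].
- by apply: rt_step; exists s, m, u; split; first exact: sSS'.
- exact: rt_refl.
- by apply: rt_trans; eassumption.
Qed.

(** * Linearity of evaluation *)

Section Evaluation.
Variables (k : fieldType) (Z : choiceType) (C : confAlg k) (zeta : Z -> C).
Implicit Types (p q s : freeMod k Z) (m : mono Z).

Lemma eval_supp p :
  eval zeta p = \sum_(m <- supp p) (coef p m)%:P *: eval_mono zeta m.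
Proof. by rewrite big_allpairs_dep. Qed.

(** Monomials outside the support contribute zero, so elements with different supports can be
    evaluated over one common list. *)
Lemma evalEw p (r : seq (mono Z)) : uniq r -> {subset supp p <= r} ->
  eval zeta p = \sum_(m <- r) (coef p m)%:P *: eval_mono zeta m.
Proof.
move=> Ur sub; rewrite eval_supp [RHS](bigID (mem (supp p))) /=.
rewrite [X in _ = _ + X]big1 => [|m]; last first.
  by rewrite mem_supp negbK => /eqP->; rewrite polyC0 scale0r.
rewrite addr0 -[RHS]big_filter; apply: perm_big.
apply: uniq_perm => [||m]; rewrite ?supp_uniq ?filter_uniq // mem_filter /=.
by case: (boolP (m \in supp p)) => // /sub ->.
Qed.

(** The combination is described by its coefficients because the scalars of [freeMod] are [opAlg],
    not [k]. *)
Lemma eval_lin (a : k) p q r :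
  (forall m, coef r m = a * coef p m + coef q m) ->
  eval zeta r = a%:P *: eval zeta p + eval zeta q.
Proof.
move=> r_pq; pose d := undup (supp r ++ supp p ++ supp q).
rewrite !(@evalEw _ d) ?undup_uniq //;
  try by move=> m mP; rewrite mem_undup !mem_cat mP ?orbT.
rewrite scaler_sumr -big_split /=; apply: eq_bigr => m _.
by rewrite r_pq polyCD polyCM scalerDl scalerA.
Qed.

Lemma eval0 : eval zeta 0 = 0.
Proof. by rewrite /eval msupp0 big_nil. Qed.

Lemma eval_term m : eval zeta (term 1 m) = eval_mono zeta m.
Proof.
rewrite (@evalEw _ [:: m]) //; first by
  rewrite big_seq1 coef_term eqxx polyC1 scale1r.
by move=> m'; rewrite mem_supp coef_term inE [m' == m]eq_sym;
  case: (m == m'); rewrite ?eqxx.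
Qed.

Lemma eval_sum_term (r : seq (mono Z)) (c : mono Z -> k) : uniq r ->
  eval zeta (\sum_(m <- r) term (c m) m) =
  \sum_(m <- r) (c m)%:P *: eval_mono zeta m.
Proof.
move=> Ur; rewrite (@evalEw _ r) // => [|m].
  by rewrite [LHS]big_seq [RHS]big_seq; apply: eq_bigr => m mr;
    rewrite coef_sum_term // mr.
rewrite mem_supp coef_sum_term //.
by case: (m \in r); rewrite ?mulr0n ?eqxx.
Qed.

End Evaluation.

(** * Homogeneity in the letters from Y *)

Section Homogeneity.
Variables (k : fieldType) (X Y : choiceType).
Local Notation Z := (X + Y)%type.
Implicit Types (p q s : freeMod k Z) (m : mono Z) (u v w : word Z).

Local Notation wcount := (fun u : word Z => count (@letterY X Y) u).

Lemma ycount_wmul u m : ycount (wmul u m) = (wcount u + ycount m)%N.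
Proof. by rewrite /ycount /wmul /= fmM count_cat addnA. Qed.

Definition op_homogeneous d (r : opAlg k Z) : Prop :=
  forall w, r@_w != 0 -> wcount w = d.

Lemma op_homogeneousB d r r' :
  op_homogeneous d r -> op_homogeneous d r' -> op_homogeneous d (r - r').
Proof.
move=> hr hr' w; rewrite mcoeffB; have [->|/hr//] := eqVneq r@_w 0.
by rewrite sub0r oppr_eq0 => /hr'.
Qed.

Lemma op_homogeneousMn d r n :
  op_homogeneous d r -> op_homogeneous d (r *+ n).
Proof.
move=> hr w; rewrite mcoeffMn => nz; apply: hr.
by apply: contraNneq nz => ->; rewrite mul0rn.
Qed.

Lemma op_homogeneousM d d' r r' :
  op_homogeneous d r -> op_homogeneous d' r' ->
  op_homogeneous (d + d') (r * r').
Proof.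
move=> hr hr' w; rewrite mcoeff_neq0 => /msuppM_le [w1 [w2 [w1P w2P ->]]].
by rewrite fmM count_cat hr ?hr' // mcoeff_neq0.
Qed.

Lemma op_homogeneous_comm d d' r r' : op_homogeneous d r ->
  op_homogeneous d' r' -> op_homogeneous (d + d') (r * r' - r' * r).
Proof.
move=> hr hr'; apply: op_homogeneousB; first exact: op_homogeneousM.
by rewrite addnC; apply: op_homogeneousM.
Qed.

Lemma op_homogeneousU w : op_homogeneous (wcount w) << w >>.
Proof.
by move=> w'; rewrite mcoeffU1; case: (eqVneq w w') => [->|_]; rewrite ?eqxx.
Qed.

(** The letter for the derivation has degree 0, and the terms of each defining relation carry the
    same generators, only reordered or with a lower index. *)
Lemma A_rule_homogeneous s : A_rule s -> exists d, Y_homogeneous d s.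
Proof.
have U1 (l : letter Z) :
    op_homogeneous (letterY l) (<< (fmu l : word Z) >> : opAlg k Z).
  by have := @op_homogeneousU (fmu l : word Z); rewrite /= fmU /= addn0.
case=> w [r [v [z [rP ->]]]].
have [d hr] : exists d, op_homogeneous d r.
  case: w r / rP => [n a|n a|n m a b].
  (* The summand 0 is the degree of [Dlet], in the shape that [op_homogeneous_comm] produces. *)
  - exists (isY a + 0)%N; apply: op_homogeneousB.
      exact: op_homogeneous_comm (U1 (Llet n a)) (U1 Dlet).
    by rewrite addn0; apply: op_homogeneousMn (U1 (Llet n.-1 a)).
  - exists (isY a + 0)%N; apply: op_homogeneousB.
      exact: op_homogeneous_comm (U1 (Rlet n a)) (U1 Dlet).
    by rewrite addn0; apply: op_homogeneousMn (U1 (Rlet n.-1 a)).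
  - exists (isY a + isY b)%N.
    exact: op_homogeneous_comm (U1 (Rlet n a)) (U1 (Llet m b)).
exists (d + wcount v + isY z)%N => -[w' z'].
rewrite /coef /ycount mcoeffU /=.
case: (eqVneq z z') => [<-|_]; last by rewrite mulr0n mcoeff0 eqxx.
by rewrite mulr1n => /(op_homogeneousM hr (@op_homogeneousU v)) ->.
Qed.

Variables (lt : rel (mono Z)).

(** The multiple [wmul u m] of the leading monomial occurs in [p], so the degrees of [u] and of the
    rule add up to [d]. Hence the rule has degree at most [d], and what is subtracted has degree [d]
    again. *)
Lemma homogeneous_rewrites d S p q :
  (forall s, S s -> exists d, Y_homogeneous d s) ->
  Y_homogeneous d p -> rewrites lt S p q ->
  Y_homogeneous d q /\
  rewrites lt (fun s => S s /\ exists2 e, (e <= d)%N & Y_homogeneous e s) p q.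
Proof.
move=> homS hp [s [m [u [Ss lead_m nz ->]]]].
have [e hs] := homS s Ss.
have dE : (wcount u + e)%N = d.
  by rewrite -(hp _ nz) ycount_wmul (hs m) //; case: lead_m.
split; last first.
  by exists s, m, u; split=> //; split=> //; exists e; rewrite // -dE leq_addl.
move=> m'; rewrite coefB; have [->|/hp //] := eqVneq (coef p m') 0.
rewrite sub0r oppr_eq0 => /coef_scale_neq0 [m'' -> nz''].
by rewrite ycount_wmul (hs _ nz'').
Qed.

End Homogeneity.

(** * Stability under the generators of C implies stability under C *)

Section SpanClosure.
Variable k : fieldType.

Lemma H_submoduleP (V : lmodType {poly k}) (P : V -> Prop) :
  P 0 -> (forall (c : k) u v, P u -> P v -> P (c%:P *: u + v)) ->
  (forall u, P u -> P ('X *: u)) -> H_submodule P.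
Proof.
move=> P0 Plin PX; split=> // h; elim/poly_ind: h => [|h c IHh] u v Pu Pv.
  by rewrite scale0r add0r.
rewrite scalerDl -addrA -scalerA; apply: IHh; [exact: PX | exact: Plin].
Qed.

Variables (C : confAlg k) (M : confMod C).
Variables (X : Type) (xi : X -> C) (N : X -> X -> nat).
Hypothesis hC : alg_generated xi N.
Variable P : M -> Prop.
Hypothesis subP : H_submodule P.
Hypothesis lactXP : forall x v n, P v -> P (lact (xi x) v)@_n.

(** The elements of C whose action preserves [P] form an H-submodule closed under all products and
    containing the generators, so they exhaust C. *)
Lemma lact_closed (a : C) v n : P v -> P (lact a v)@_n.
Proof.
have [P0 Plin] := subP.
have PZ h u : P u -> P (h *: u).
  by move=> Pu; rewrite -[_ *: _]addr0; apply: Plin.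
have PN u : P u -> P (- u) by rewrite -scaleN1r; apply: PZ.
have PD u w : P u -> P w -> P (u + w).
  by move=> Pu; rewrite -[u]scale1r; apply: Plin.
move: v n; pose Q (a : C) := forall v n, P v -> P (lact a v)@_n.
apply: (alg_gen hC (P := Q)) => [|a1 a2 n Q1 Q2|x v n]; last exact: lactXP.
  apply: H_submoduleP => [v n _|c a1 a2 Q1 Q2 v n Pv|a1 Q1 v n Pv].
  (* Linearity with scalar -1 and both arguments 0 shows that 0 acts as zero. *)
  - have := act_linearl (lactP M) (-1) 0 0 v n.
    by rewrite scaler0 addr0 polyCN scaleN1r addNr => ->.
  - by rewrite (act_linearl (lactP M)); apply: Plin; [apply: Q1 | apply: Q2].
  - by rewrite (act_derl (lactP M)); apply: PN; case: n => //= n; apply: Q1.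
(* The coefficient of lambda^n mu^m in a1_lambda (a2_mu v) is (a1_n a2)_m v
   plus multiples of (a1_l a2)_i v with l < n. *)
elim/ltn_ind: n => n IHn v m Pv.
have := act_assoc (lactP M) a1 a2 v n m.
rewrite big_ord_recr /= subnn add0n binn mulr1n.
move/esym/(canRL (addKr _)) => ->.
apply: (PD _ _); last by apply: Q1; apply: Q2.
apply: PN; elim/big_ind: _ => [//||l _]; first exact: PD.
rewrite -scaler_nat; apply: PZ.
exact: IHn.
Qed.

End SpanClosure.

(** * Values of monomials in the split null extension *)

Section SplitNull.
Variables (k : fieldType) (C : confAlg k) (M : confMod C) (X Y : choiceType).
Variables (xi : X -> C) (eta : Y -> M).
Implicit Types (m : mono (X + Y)%type).
Local Notation ev := (eval_mono (split_gen xi eta)).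

Lemma lprod0l (b : C) n : (lprod 0 b)@_n = 0.
Proof.
have := act_linearl (lprodP C) (-1) 0 0 b n.
by rewrite scaler0 addr0 polyCN scaleN1r addNr.
Qed.

Lemma lprod0r (a : C) n : (lprod a 0)@_n = 0.
Proof.
have := act_linearr (lprodP C) (-1) a 0 0 n.
by rewrite scaler0 addr0 polyCN scaleN1r addNr.
Qed.

Lemma Lop1 n (a u : split_null M) :
  (Lop n a u).1 = n`!%:R *: (lprod a.1 u.1)@_n.
Proof. by rewrite /Lop /= split_null_prodE. Qed.

Lemma Lop2 n (a u : split_null M) :
  (Lop n a u).2 = n`!%:R *: (lact a.1 u.2)@_n.
Proof. by rewrite /Lop /= split_null_prodE. Qed.

Lemma Rop1_eq0 n (a u : split_null M) :
  (forall j, (lprod u.1 a.1)@_j = 0) -> (Rop n a u).1 = 0.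
Proof.
move=> ua0; rewrite /Rop; elim/big_ind: _ => // [x y x0 y0|j _].
  by rewrite /= x0 y0 addr0.
by rewrite /= split_null_prodE /= ua0 scaler0.
Qed.

(** The C-component of a product is the product of the C-components, and here one of these is
    zero. *)
Lemma letter_op_Y (l : letter (X + Y)%type) (u : split_null M) :
  u.1 = 0 \/ letterY l -> (letter_op (split_gen xi eta) l u).1 = 0.
Proof.
case: l => [|n a|n a] uY; rewrite /letter_op.
- by case: uY => //= ->; rewrite scaler0.
- rewrite Lop1; case: uY => [->|]; first by rewrite lprod0r scaler0.
  by case: a => //= y _; rewrite lprod0l scaler0.
- apply: Rop1_eq0 => j; case: uY => [->|]; first exact: lprod0l.
  by case: a => //= y _; apply: lprod0r.
Qed.

(** The first letter from Y, read from the right, puts the value into M, and no later operator leads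
    out of M. *)
Lemma eval_mono_Y m : (0 < ycount m)%N -> (ev m).1 = 0.
Proof.
case: m => w z; rewrite /ycount /eval_mono [(w, z).1]/= [(w, z).2]/=.
elim: (w : seq _) => [|l s IHs]; first by case: z.
rewrite /= -addnA => cY; apply: letter_op_Y.
by case: (letterY l) cY => [|/IHs]; [right | left].
Qed.

Lemma eval_snd (p : freeMod k (X + Y)%type) :
  (eval (split_gen xi eta) p).2 =
  \sum_(m <- supp p) (coef p m)%:P *: (ev m).2 :> M.
Proof.
rewrite eval_supp.
exact: (big_morph (fun x : split_null M => x.2) (fun _ _ => erefl) erefl).
Qed.

End SplitNull.

(** * Confluence, independence and spanning for the module *)

Section ModuleBasis.
Variables (k : fieldType) (C : confAlg k) (M : confMod C) (X Y : choiceType).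
Variables (xi : X -> C) (eta : Y -> M) (lt : rel (mono (X + Y)%type)).
Variable G : freeMod k (X + Y)%type -> Prop.
Hypothesis hlt : monomial_order k lt.
Hypothesis hG : GSB (split_gen xi eta) lt G.
Hypothesis hG_homogeneous : forall g, G g -> exists d, Y_homogeneous d g.
Implicit Types (m : mono (X + Y)%type) (p q s : freeMod k (X + Y)%type).
Local Notation ev := (eval_mono (split_gen xi eta)).
Local Notation Ev := (eval (split_gen xi eta)).

Definition all_rules := union_rules (@A_rule k (X + Y)%type) G.
Definition module_rules := union_rules (@A_rule k (X + Y)%type)
  (union_rules (fun g => G g /\ Y_homogeneous 0 g)
               (fun g => G g /\ Y_homogeneous 1 g)).
Definition single m := ycount m = 1%N.
Definition normal m := single m /\ irreducible_mono lt module_rules m.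

Lemma module_rules_all s : module_rules s -> all_rules s.
Proof. by case=> [?|[[? _]|[? _]]]; [left | right | right]. Qed.

Lemma all_rules_module s : all_rules s ->
  (exists2 e, (e <= 1)%N & Y_homogeneous e s) -> module_rules s.
Proof.
case=> [As _|Gs [[|[|e]] // _ hs]]; first by left.
  by right; left.
by right; right.
Qed.

Lemma all_rules_homogeneous s : all_rules s -> exists d, Y_homogeneous d s.
Proof. by case=> [/A_rule_homogeneous|/hG_homogeneous]. Qed.

Lemma single_rewrites_star p q : Y_homogeneous 1 p ->
  rewrites_star lt all_rules p q -> rewrites_star lt module_rules p q.
Proof.
move=> hp /clos_rt_rt1n_iff pq.
elim: pq hp => [r _|r r' r'' step _ IH hr]; first exact: rt_refl.
have [hr' [s [m [u [[Ss hs] lead_m nz eq_r']]]]] :=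
  homogeneous_rewrites all_rules_homogeneous hr step.
apply: rt_trans (IH hr'); apply: rt_step; exists s, m, u; split=> //.
exact: all_rules_module.
Qed.

(** A common reduct exists under all rules; the reductions leading to it start in degree 1, so they
    use module rules only. *)
Lemma module_rules_confluent : confluent_on lt single module_rules.
Proof.
have up := sub_rewrites_star module_rules_all.
have hom p q : Y_homogeneous 1 p -> rewrites_star lt module_rules p q ->
    Y_homogeneous 1 q.
  move=> hp /up /clos_rt_rt1n_iff pq.
  elim: pq hp => // r r' r'' step _ IH hr; apply: IH.
  by have [] := homogeneous_rewrites all_rules_homogeneous hr step.
move=> p q q' hp pq pq'.
have [|r qr q'r] := hG.2 _ _ _ _ (up _ _ _ pq) (up _ _ _ pq'); first by [].
by exists r; apply: single_rewrites_star => //; apply: hom hp _.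
Qed.

Lemma rule_eval0 t s : all_rules s -> Ev (t *: s) = 0.
Proof.
move=> Ss; apply/(hG.1 _); rewrite -[_ *: _]addr0.
by apply: submodD => //; apply: submod0.
Qed.

(** A rule whose leading monomial is a right factor of a monomial of degree 1 has degree at most 1,
    so it is a module rule. *)
Lemma normal_irreducible m : normal m -> irreducible_mono lt all_rules m.
Proof.
case=> m1 irr s m' u Ss lead_m' def_m; apply: (irr s m' u) => //.
apply: all_rules_module => //; have [d hs] := all_rules_homogeneous Ss.
exists d => //; rewrite -m1 def_m ycount_wmul (hs m') ?leq_addl //.
by case: lead_m'.
Qed.

Lemma normal_free (r : seq (mono (X + Y)%type)) (c : mono (X + Y)%type -> k) :
  uniq r -> (forall m, m \in r -> normal m) ->
  \sum_(m <- r) (c m)%:P *: (ev m).2 = 0 -> forall m, m \in r -> c m = 0.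
Proof.
move=> Ur nr sum0 m mr; pose p := \sum_(m <- r) term (c m) m.
have nz_r m' : coef p m' != 0 -> m' \in r.
  by rewrite coef_sum_term //; case: (m' \in r); rewrite ?mulr0n ?eqxx.
have Ep0 : Ev p = 0.
  rewrite eval_sum_term //.
  (* The hypothesis on M controls only the second component; the first vanishes termwise. Sublists
     of [r] make the induction possible. *)
  have sumE (a : seq _) : {subset a <= r} ->
      \sum_(m <- a) (c m)%:P *: ev m = (0, \sum_(m <- a) (c m)%:P *: (ev m).2).
    elim: a => [|m' a IHa] sub; first by rewrite !big_nil.
    rewrite !big_cons IHa => [|m'' m''a]; last first.
      by apply: sub; rewrite inE m''a orbT.
    have [m'1 _] := nr _ (sub _ (mem_head _ _)).
    rewrite [ev m']surjective_pairing eval_mono_Y ?m'1 //.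
    by congr (_, _); rewrite /= scaler0 addr0.
  by rewrite sumE // sum0.
have p0 : p = 0.
  apply: (irreducible_submodule hlt hG.2); last exact/(hG.1 _).
  by move=> m' /nz_r /nr /normal_irreducible.
by have := coef0 k m; rewrite -p0 coef_sum_term // mr.
Qed.

(** Keeping the combination as an element of [freeMod] makes sums available without merging lists of
    monomials. *)
Definition normal_span (v : M) : Prop :=
  exists2 p, (forall m, coef p m != 0 -> normal m) & v = (Ev p).2.

Lemma normal_span0 : normal_span 0.
Proof.
by exists 0; [move=> m; rewrite coef0 eqxx | rewrite eval0].
Qed.

Lemma normal_span_lin (c : k) u v :
  normal_span u -> normal_span v -> normal_span (c%:P *: u + v).
Proof.
move=> [p np ->] [q nq ->].
have coefZ m : coef ((<< c *g mone >> : opAlg k _) *: p + q) m =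
    c * coef p m + coef q m.
  by rewrite coefD /coef mcoeffZ mcoeffCM.
exists ((<< c *g mone >> : opAlg k _) *: p + q).
  move=> m; rewrite coefZ; have [->|/np//] := eqVneq (coef p m) 0.
  by rewrite mulr0 add0r => /nq.
by rewrite (eval_lin _ coefZ).
Qed.

Lemma normal_spanZ (c : k) u : normal_span u -> normal_span (c%:P *: u).
Proof.
by move=> Pu; rewrite -[_ *: u]addr0; apply: normal_span_lin normal_span0.
Qed.

Lemma normal_span_sum (I : eqType) (r : seq I) (c : I -> k) (f : I -> M) :
  (forall i, i \in r -> normal_span (f i)) ->
  normal_span (\sum_(i <- r) (c i)%:P *: f i).
Proof.
move=> Pf; rewrite big_seq; elim/big_rec: _ => [|i v /Pf Pi Pv].
  exact: normal_span0.
exact: normal_span_lin.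
Qed.

(** By well-founded induction on the order: one rewriting step at a reducible monomial preserves its
    value and leaves only smaller monomials of the same degree. *)
Lemma single_span m : single m -> normal_span (ev m).2.
Proof.
elim/(well_founded_ind (mo_wf hlt)): m => m IHm m1.
have [irr|] := classic (irreducible_mono lt module_rules m).
  exists (term 1 m) => [m'|]; last by rewrite eval_term.
  rewrite coef_term; case: (eqVneq m m') => [<- _ //|_].
  by rewrite mulr0n eqxx.
(* Classical logic extracts from reducibility an actual rule [s] and a factor [u]. *)
move=> /not_all_ex_not [s] /not_all_ex_not [m'] /not_all_ex_not [u] red.
have [Ss [lead_m' def_m]] : module_rules s /\ is_lead lt s m' /\ m = wmul u m'.
  apply: NNPP => no; apply: red => Ss lead_m' def_m; exact: no.
have [lc0 lead] := lead_m'.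
have [d hs] := all_rules_homogeneous (module_rules_all Ss).
(* The rule is made monic at [m'], so that [m] cancels in [q]. *)
pose q := term 1 m - (<< (coef s m')^-1 *g u >> : opAlg k _) *: s.
have qlt m'' : coef q m'' != 0 -> lt m'' m /\ single m''.
  rewrite coefB coef_term.
  case: (eqVneq m m'') => [<-|mm''].
    by rewrite mulr1n def_m coef_scale_wmul mulVf // subrr eqxx.
  rewrite mulr0n sub0r oppr_eq0 => /coef_scale_neq0 [m0 def_m'' nz0].
  split.
    rewrite def_m'' def_m; apply: (mo_mul hlt); apply: lead => //.
    by apply: contraNneq mm'' => eq_m0; rewrite def_m'' def_m eq_m0.
  rewrite /single def_m'' ycount_wmul (hs _ nz0) -(hs _ lc0) -ycount_wmul.
  by rewrite -def_m.
have -> : ev m = Ev q.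
  rewrite -eval_term.
  rewrite (@eval_lin _ _ _ _ 1
    ((<< (coef s m')^-1 *g u >> : opAlg k _) *: s) q).
    by rewrite rule_eval0 ?scaler0 ?add0r //; apply: module_rules_all.
  by move=> m''; rewrite mul1r -coefD /q addrC subrK.
rewrite eval_snd.
by apply: normal_span_sum => m''; rewrite mem_supp => /qlt [? ?]; apply: IHm.
Qed.

Hypothesis k_char0 : [pchar k] =i pred0.
Variables (N : X -> X -> nat) (N' : X -> Y -> nat).
Hypothesis hC : alg_generated xi N.
Hypothesis hM : mod_generated xi eta N'.

Lemma normal_span_map (f : M -> M) :
  (forall (c : k) u v, f (c%:P *: u + v) = c%:P *: f u + f v) ->
  (forall m, single m -> normal_span (f (ev m).2)) ->
  forall v, normal_span v -> normal_span (f v).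
Proof.
move=> f_lin f_ev _ [p np ->]; rewrite eval_snd big_seq.
elim/big_rec: _ => [|m v].
  have := f_lin (-1) 0 0; rewrite scaler0 addr0 polyCN scaleN1r addNr => ->.
  exact: normal_span0.
by rewrite mem_supp f_lin => /np [m1 _]; apply: normal_span_lin; apply: f_ev.
Qed.

(** Prefixing [l] gives another monomial with one letter from Y, to which [single_span] applies even
    if it is reducible. *)
Lemma single_span_letter l m : letterY l = false -> single m ->
  normal_span (letter_op (split_gen xi eta) l (ev m)).2.
Proof.
move=> lY m1.
have := @single_span (wmul (fmu l : word _) m).
rewrite /eval_mono /= fmM fmU /=; apply.
by rewrite /single ycount_wmul fmU /= lY.
Qed.

(** The span contains each [eta y] as the value of an empty word, and it is stable under the
    derivation and the coefficients of each [xi x], hence under C by [lact_closed]. *)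
Lemma normal_span_full v : normal_span v.
Proof.
have spanX v' : normal_span v' -> normal_span ('X *: v').
  apply: normal_span_map => [c u w|m m1].
    by rewrite scalerDr !scalerA mulrC.
  exact: (@single_span_letter Dlet).
have subP := H_submoduleP normal_span0 normal_span_lin spanX.
apply: (mod_gen hM subP) => [a v' n|y]; last first.
  have := @single_span (mone, inr y).
  by rewrite /single /ycount /eval_mono /= fm1 /=; apply.
apply: (lact_closed hC subP) => x {}v' {}n.
apply: (@normal_span_map (fun v' => (lact (xi x) v')@_n)) => [c u w|m m1].
    exact: (act_linearr (lactP M)).
  (* [Lop] is n! times the coefficient of the action; characteristic zero allows division by n!. *)
  have n0 : (n`!%:R : k) != 0.
    have /pcharf0P -> := k_char0.
    by rewrite -lt0n fact_gt0.
  have := @single_span_letter (Llet n (inl x)) _ erefl m1.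
  rewrite /letter_op Lop2 => /(normal_spanZ (n`!%:R^-1)).
  rewrite scalerA -polyC_natr -polyCM mulVf // polyC1 scale1r.
  exact.
Qed.

End ModuleBasis.

Theorem corollary1 (k : fieldType) (k_char0 : [pchar k] =i pred0)
  (X Y : choiceType) (N : X -> X -> nat) (N' : X -> Y -> nat)
  (C : confAlg k) (xi : X -> C) (hC : alg_generated xi N)
  (M : confMod C) (eta : Y -> M) (hM : mod_generated xi eta N')
  (lt : rel (mono (X + Y)%type)) (hlt : monomial_order k lt)
  (G : freeMod k (X + Y)%type -> Prop)
  (hG : GSB (split_gen xi eta) lt G)
  (hG_homogeneous : forall g, G g -> exists d, Y_homogeneous d g) :
  module_GSB xi eta lt G (fun g => G g /\ Y_homogeneous 1 g).
Proof.
split=> [s [] //|s [Gs _]||].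
- by rewrite -[s]scale1r; apply: (rule_eval0 hG); right.
- exact: (module_rules_confluent hG hG_homogeneous).
- split=> [r c Ur nr|v].
    exact: (normal_free hlt hG hG_homogeneous Ur nr).
  have [p np ->] := normal_span_full hlt hG hG_homogeneous k_char0 hC hM v.
  exists (supp p), (coef p); split=> [m|]; last exact: eval_snd.
  by rewrite mem_supp => /np.
Qed.
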